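(* Let $X$ be a real topological-linear space, $Y$ a real locally convex space with dimension two or higher, $\Omega\subseteq X$ nonempty, $f:X\to Y$, $\mathbb A:\Omega\to2^Y$ a cone-valued map, and $\|\cdot\|:Y\to\mathbb R$ a continuous norm. Assume that $K:=C_{\|\cdot\|}(y^*,\beta)$ for some $(y^*,\beta)\in(Y^*\setminus\{0\})\times\mathbb P$ is nontrivial, $\bar x\in\mathrm{PEff}_{\mathbb A}(\Omega\mid f,K)$, and $A:=\mathbb A(\bar x)$ is a cone in $Y$ with $\{0\}\ne f[\Omega]-f(\bar x)\subseteq A$. Suppose that one of the sets $\operatorname{cl}S_{-K}(\|\cdot\|)$ and $\operatorname{cl}S^0_A(\|\cdot\|)$ is compact. Moreover, assume that either $A$ is closed and convex or one of the following conditions holds: $B_A(\|\cdot\|)$ is compact; or $S^0_A(\|\cdot\|)$ is closed; or $A$ is closed and $\operatorname{cl}B_A(\|\cdot\|)$ is compact; or $A$ is closed and $\operatorname{conv}(\operatorname{cl}(B_A(\|\cdot\|))\cup\{0\})$ is closed. Then there is $(x^*,\alpha)\in K^{a\#}(\|\cdot\|)\cap(Y^*\times\mathbb P)$ such that, with $C:=C_{\|\cdot\|}(x^*,\alpha)$, $\bar x\in\mathrm{Eff}(\Omega\mid f,C)$. Moreover, if $C\neq\ell(C)$ and $\varphi:Y\to\mathbb R$ is a sublinear functional with $\varphi(0)=0$ which is $-C$ representing, then: (i) for any $k\in C\setminus\ell(C)$, $\{(x,0)\mid x\in\Omega,\ f(x)=f(\bar x)\}$ is the set of solutions of $(P_\varphi^{a,k})$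 for $a=f(\bar x)$; (ii) $\{x\in\Omega\mid f(x)=f(\bar x)\}=\operatorname{argmin}_{x\in\Omega}\varphi(f(x)-f(\bar x))$; (iii) if $\mathcal P\subseteq Y$, $\mathcal T\subseteq C\setminus\ell(C)$, $\mathcal R\subseteq\mathbb R$ satisfy $f[\mathrm{Eff}(\Omega\mid f,C)]\subseteq\mathcal P+\mathcal R\cdot\mathcal T$, then there are $a\in\mathcal P$, $k\in\mathcal T$, $s\in\mathcal R$ so that $\{(x,s)\mid x\in\Omega,\ f(x)=f(\bar x)\}$ is the set of solutions of $(P_\varphi^{a,k})$; (iv) if, in addition to the assumption in (iii), $C$ is closed, then there are $a\in\mathcal P$, $k\in\mathcal T$, $s\in\mathcal R$ so that $\varphi^G_{a-C,k}(f(\bar x))=s$ and $\{x\in\Omega\mid f(x)=f(\bar x)\}=\operatorname{argmin}_{x\in\Omega}\varphi^G_{a-C,k}(f(x))$.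
   Context: $Y^*$ is the topological dual of $Y$ (with respect to its locally convex topology), $\mathbb R_+=[0,\infty)$, $\mathbb P=(0,\infty)$. The norm $\|\cdot\|$ is continuous but need not generate the topology of $Y$; closures and compactness refer to the locally convex topology. A set $K\subseteq Y$ is a cone if $0\in K=\mathbb R_+\cdot K$; it is nontrivial if $\{0\}\ne K\ne Y$; $\ell(K):=K\cap(-K)$. For a cone $M$ and $\psi=\|\cdot\|$: $B_M(\psi):=\{x\in M\mid\psi(x)=1\}$, $S_M(\psi):=\operatorname{conv}(B_M(\psi))$, $S^0_M(\psi):=\operatorname{conv}(\{0\}\cup B_M(\psi))$. $K^{a\#}(\psi):=\{(x^*,\alpha)\in Y^*\times\mathbb R_+\mid\forall y\in K\setminus\{0\}:\ x^*(y)-\alpha\psi(y)>0\}$. $C_\psi(x^*,\alpha):=\{y\in Y\mid x^*(y)\ge\alpha\psi(y)\}$. $\varphi$ is $-C$ representing if $-C=\{y\in Y\mid\varphi(y)\le0\}$. $\mathrm{Eff}(\Omega\mid f,C)$ is the set of $\bar x\in\Omega$ for which there is no $x\in\Omega$ with $f(x)\in f(\bar x)-(C\setminus\{0\})$; $\mathrm{PEff}_{\mathbb A}(\Omega\mid f,K)$ is the set of $\bar x\in\mathrm{Eff}(\Omega\mid f,K)$ with $\mathbb A(\bar x)\cap(-K)=\{0\}$. $f[D]$ is the image of $D$. $(P_\varphi^{a,k})$ is the problem: minimize $\lambda$ subject to $\varphi(f(x)-a-\lambda k)\le0$, $(x,\lambda)\in\Omega\times\mathbb R$; a solution is a feasible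 pair with $\lambda$ minimal among all feasible pairs. $\varphi^G_{a-C,k}(y):=\inf\{t\in\mathbb R\mid y\in tk+(a-C)\}\in\mathbb R\cup\{\pm\infty\}$ ($\inf\emptyset=+\infty$). *)

(* Defs.v *)
From mathcomp Require Import all_boot all_order all_algebra.
From mathcomp Require Import all_classical all_reals all_analysis.

Set Implicit Arguments.
Unset Strict Implicit.
Unset Printing Implicit Defensive.

Import Order.TTheory GRing.Theory Num.Theory.
Import numFieldNormedType.Exports.

Local Open Scope classical_set_scope.
Local Open Scope ring_scope.

Section VectorSpace.
Variables (R : realType) (Y : lmodType R).
Implicit Types (K M : set Y) (psi phi : Y -> R).

Definition dim_ge2 : Prop :=
  exists u v : Y, forall a b : R, a *: u + b *: v = 0 -> a = 0 /\ b = 0.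

Definition is_norm psi : Prop :=
  [/\ forall x y, psi (x + y) <= psi x + psi y,
      forall (t : R) x, psi (t *: x) = `|t| * psi x
    & forall x, psi x = 0 -> x = 0].

Definition sublinear phi : Prop :=
  (forall x y, phi (x + y) <= phi x + phi y) /\
  (forall (t : R) x, 0 < t -> phi (t *: x) = t * phi x).

Definition opp_set K : set Y := [set - y | y in K].

Definition cone K : Prop :=
  K 0 /\ K = [set t *: y | t in [set t : R | 0 <= t] & y in K].

Definition nontrivial K : Prop := [set 0] <> K /\ K <> setT.

Definition lineality K : set Y := K `&` opp_set K.

Definition conv_hull K : set Y := smallest (@convex_set R Y) K.

(* B_M(psi), S_M(psi) and S^0_M(psi), in this order. *)
Definition base psi M : set Y := [set x | M x /\ psi x = 1].

Definition conv_base psi M : set Y := conv_hull (base psi M).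

Definition conv_base0 psi M : set Y := conv_hull ([set 0] `|` base psi M).

(* C_psi(x*, alpha) *)
Definition BP_cone psi (xs : Y -> R) (alpha : R) : set Y :=
  [set y | alpha * psi y <= xs y].

(* With D = -C this is "phi is -C representing". *)
Definition representing phi (D : set Y) : Prop := D = [set y | phi y <= 0].

(* phi^G_{a - C, k}; ereal_inf set0 is +oo. *)
Definition gerstewitz (a : Y) (C : set Y) (k : Y) (y : Y) : \bar R :=
  ereal_inf [set t%:E | t in
    [set t : R | [set t *: k + (a - c) | c in C] y]].

End VectorSpace.

Arguments dim_ge2 {R} Y.

Section Dual.
Variables (R : realType) (Y : tvsType R).

Definition top_dual : set (Y -> R) :=
  [set xs | linear (xs : Y -> R^o) /\ continuous xs].

(* K^{a#}(psi) *)
Definition aug_dual (psi : Y -> R) (K : set Y) : set ((Y -> R) * R) :=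
  [set p | [/\ top_dual p.1, 0 <= p.2 &
    forall y, (K `\ 0) y -> 0 < p.1 y - p.2 * psi y]].

End Dual.

Arguments top_dual {R} Y.

Section Optimization.
Variables (R : realType) (X : Type) (Y : lmodType R).
Variables (Omega : set X) (f : X -> Y).

Definition Eff (C : set Y) : set X :=
  [set xb | Omega xb /\
    ~ (exists2 x, Omega x & [set f xb - c | c in C `\ 0] (f x))].

(* PEff_A; AA is only relevant on Omega. *)
Definition PEff (AA : X -> set Y) (K : set Y) : set X :=
  [set xb | Eff K xb /\ AA xb `&` opp_set K = [set 0]].

(* Feasible pairs and solutions of (P_phi^{a,k}). *)
Definition feasible (phi : Y -> R) (a k : Y) : set (X * R) :=
  [set p | Omega p.1 /\ phi (f p.1 - a - p.2 *: k) <= 0].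

Definition solutions (phi : Y -> R) (a k : Y) : set (X * R) :=
  [set p | feasible phi a k p /\
    forall q, feasible phi a k q -> p.2 <= q.2].

End Optimization.

Definition argmin (d : Order.disp_t) (T : porderType d) (X : Type)
    (D : set X) (g : X -> T) : set X :=
  [set x | D x /\ forall z, D z -> (g x <= g z)%O].

(* Main.v *)
Require Import Defs.
From mathcomp Require Import all_boot all_order all_algebra.
From mathcomp Require Import all_classical all_reals all_analysis.
From mathcomp Require Import lra.
Import Order.TTheory GRing.Theory Num.Theory.
Import numFieldNormedType.Exports.
Local Open Scope classical_set_scope.
Local Open Scope ring_scope.

(** Since [A] meets [-K] only at [0], one has [y* > -beta] on the base of [A],
    hence on [S^0_A], while [y* <= -beta] on [cl S_{-K}]; each of the closedness
    alternatives makes the first inequality survive on [cl S^0_A]. If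
    [cl S^0_A] is compact, then [y*] attains its minimum there and [(y*, alpha)]
    works for some [alpha < beta]. If [cl S_{-K}] is compact, the two closures are
    strictly separated by some [x*] in the dual, and the separating level is
    [-alpha < 0] because [0] belongs to [S^0_A]. As [C] is a pointed convex cone,
    [f(x) in f(xb) - C] forces [f(x) = f(xb)] on [Omega], and the scalarization
    results follow by writing [f(xb) = a + s k]. *)

(** * Hahn-Banach theorem through maximal convex cones in [Y * R] *)

Section HahnBanach.
Context {R : realType} {Y : lmodType R}.
Implicit Types (E : set (Y * R)) (g : Y -> R).

(** Models the epigraph of a sublinear functional, recovered as the infimum of each fibre; the last
    clause keeps that infimum finite once all fibres are nonempty. *)
Definition upper_cone E : Prop :=
  [/\ E (0, 0),
      forall x y r s, E (x, r) -> E (y, s) -> E (x + y, r + s),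
      forall t x r, 0 < t -> E (x, r) -> E (t *: x, t * r)
    & forall r, E (0, r) -> 0 <= r].

Lemma upper_cone_bigcup (F : set (set (Y * R))) :
  F !=set0 -> F `<=` upper_cone -> total_on F subset ->
  upper_cone (\bigcup_(E in F) E).
Proof.
move=> [E0 FE0] Fc Ftot; split.
- by exists E0 => //; have [] := Fc _ FE0.
- move=> x y r s [E1 FE1 E1x] [E2 FE2 E2y].
  have [E12|E21] := Ftot _ _ FE1 FE2.
    exists E2 => //; have [_ add _ _] := Fc _ FE2.
    by apply: add => //; exact: E12.
  exists E1 => //; have [_ add _ _] := Fc _ FE1.
  by apply: add => //; exact: E21.
- move=> t x r t0 [E FE Ex]; exists E => //.
  by have [_ _ sc _] := Fc _ FE; exact: sc.
- by move=> r [E FE E0r]; have [_ _ _] := Fc _ FE; exact.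
Qed.

Lemma maximal_upper_cone E0 : upper_cone E0 ->
  exists E, [/\ E0 `<=` E, upper_cone E &
    forall E', E `<=` E' -> upper_cone E' -> E' `<=` E].
Proof.
move=> cE0.
(* [Zorn_bigcup] also ranges over the empty chain, whence the guard. *)
pose P := [set E | E !=set0 -> E0 `<=` E /\ upper_cone E].
have [F FP Ftot|E [PE Emax]] := @Zorn_bigcup _ P.
  move=> [z [E1 FE1 E1z]]; pose F' := [set E | F E /\ E !=set0].
  have F'1 : F' E1 by split => //; exists z.
  have -> : \bigcup_(E in F) E = \bigcup_(E in F') E.
    apply/seteqP; split=> [y [E FE Ey]|y [E [FE _] Ey]]; last by exists E.
    by exists E => //; split => //; exists y.
  split.
    by move=> y E0y; exists E1 => //; have [+ _] := FP _ FE1 F'1.2; apply.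
  apply: upper_cone_bigcup; first by exists E1.
    by move=> E [FE /(FP _ FE)[]].
  by move=> A B [FA _] [FB _]; exact: Ftot.
have E0n : E0 (0, 0) by case: cE0.
have En0 : E !=set0.
  apply: contrapT => nE; apply: (Emax E0); last by move=> _; split.
  split=> [z Ez|E0E]; exfalso; apply: nE; first by exists z.
  by exists (0, 0); exact: E0E.
have [E0E cE] := PE En0; exists E; split => // E' EE' cE'.
apply: contrapT => nE'; apply: (Emax E'); first by split.
by move=> _; split => //; exact: subset_trans EE'.
Qed.

(** A point of the new cone over [0] comes from [x = t *: y]; for [t > 0], dividing by [t] moves it
    to the fibre over [y], where [m] is a lower bound. *)
Lemma upper_cone_extend E y m : upper_cone E ->
  (forall r, E (y, r) -> m <= r) ->
  upper_cone [set q | exists x r t, [/\ 0 <= t, E (x, r) &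
                                     q = (x - t *: y, r - t * m)]].
Proof.
move=> [E0 Eadd Esc Epos] mE; split.
- by exists 0, 0, 0; split => //; rewrite scale0r mul0r !subr0.
- move=> _ _ _ _ [x [r [t [t0 Ex [-> ->]]]]] [x' [r' [t' [t'0 Ex' [-> ->]]]]].
  exists (x + x'), (r + r'), (t + t'); split; [exact: addr_ge0|exact: Eadd|].
  by rewrite scalerDl mulrDl !opprD; congr pair; exact: addrACA.
- move=> a _ _ a0 [x [r [t [t0 Ex [-> ->]]]]].
  exists (a *: x), (a * r), (a * t); split; first by rewrite mulr_ge0// ltW.
    exact: Esc.
  by rewrite scalerBr mulrBr scalerA mulrA.
- move=> _ [x [r [t [t0 Ex [/esym/eqP + ->]]]]].
  rewrite subr_eq0 => /eqP xty; move: t0 Ex; rewrite xty le_eqVlt.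
  case/predU1P => [<-|t0]; first by rewrite scale0r mul0r subr0; exact: Epos.
  have ti0 : 0 < t^-1 by rewrite invr_gt0.
  move=> /(Esc _ _ _ ti0); rewrite scalerA mulVf ?gt_eqF// scale1r => /mE.
  by rewrite ler_pdivlMl// subr_ge0.
Qed.

(* The graph of [g] is the lineality space of a maximal upper cone above [E0]. *)
Theorem hahn_banach E0 : upper_cone E0 -> (forall y, exists r, E0 (y, r)) ->
  exists2 g, linear (g : Y -> R^o) & forall y r, E0 (y, r) -> g y <= r.
Proof.
move=> cE0 E0tot; have [E [E0E cE Emax]] := maximal_upper_cone _ cE0.
have [E0n Eadd Esc Epos] := cE.
pose g y := inf [set r | E (y, r)].
have glb y r : E (y, r) -> g y <= r.
  (* A point [s] of the fibre over [- y] bounds the fibre over [y] below by [- s], so [inf] does not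
     take its default value. *)
  move=> Eyr; apply: ge_inf => //; have [s /E0E Es] := E0tot (- y).
  exists (- s) => u Eu; have := Eadd _ _ _ _ Eu Es.
  by rewrite subrr => /Epos; rewrite lerNl => ?; lra.
(* Adjoining [(- y, - g y)] gives an upper cone again, so by maximality this point already lies in
   [E]. *)
have gE y : E (- y, - g y).
  apply: (Emax _ _ (upper_cone_extend _ y (g y) cE (glb y))).
    by move=> [x r] Ex; exists x, r, 0; split => //; rewrite scale0r mul0r !subr0.
  by exists 0, 0, 1; split => //; rewrite !sub0r scale1r mul1r.
(* [B] is a linear subspace with exactly one point over each [y], which makes [g] linear. *)
pose B y r := E (y, r) /\ E (- y, - r).
have Bg y : B y (g y).
  split; last exact: gE.
  suff -> : g y = - g (- y) by rewrite -[X in E (X, _)]opprK; exact: gE.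
  apply/eqP; rewrite eq_le; apply/andP; split.
    by apply: glb; rewrite -{1}[y]opprK; exact: gE.
  rewrite lerNl; apply: lb_le_inf => [|s Es].
    by have [s /E0E Es] := E0tot (- y); exists s.
  rewrite lerNl; apply: lb_le_inf => [|r Er].
    by have [r /E0E Er] := E0tot y; exists r.
  by have := Eadd _ _ _ _ Er Es; rewrite subrr => /Epos; lra.
have Buniq y r s : B y r -> B y s -> r = s.
  move=> [Er Enr] [Es Ens].
  have := Eadd _ _ _ _ Er Ens; rewrite subrr => /Epos.
  by have := Eadd _ _ _ _ Es Enr; rewrite subrr => /Epos; lra.
have BD x y r s : B x r -> B y s -> B (x + y) (r + s).
  by move=> [? ?] [? ?]; split; rewrite ?opprD; exact: Eadd.
have BZ a x r : B x r -> B (a *: x) (a * r).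
  move=> [Ex Enx]; have [a0|a0|->] := ltgtP a 0.
  - have na0 : 0 < - a by rewrite oppr_gt0.
    by split; [rewrite -[a]opprK scaleNr -scalerN mulNr -mulrN
              |rewrite -scaleNr -mulNr]; exact: Esc.
  - by split; rewrite -?scalerN -?mulrN; exact: Esc.
  - by rewrite scale0r mul0r /B !oppr0; split.
exists g; last by move=> y r /E0E; exact: glb.
by move=> a u v; apply: (Buniq (a *: u + v)) => //; apply: BD => //; exact: BZ.
Qed.

End HahnBanach.

(** * Convex sets and separation without topology *)

Section Convexity.
Context {R : realType} {Y : lmodType R}.
Implicit Types (A B D V : set Y) (g : Y -> R).

Lemma convex_setP A : @convex_set R Y A <->
  forall x y t, 0 <= t -> t <= 1 -> A x -> A y -> A (t *: x + (1 - t) *: y).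
Proof.
split=> [cA x y t t0 t1 Ax Ay|cA x y t /set_mem Ax /set_mem Ay].
  by have /set_mem := cA x y (Itv01 t0 t1) (mem_set Ax) (mem_set Ay).
by apply/mem_set; exact: cA.
Qed.

(** Dividing by [a + b] gives a convex combination; if [a + b = 0], both weights vanish. This is how
    cones generated by convex sets are added. *)
Lemma convex_comb A a b x y : @convex_set R Y A -> 0 <= a -> 0 <= b ->
  A x -> A y -> exists2 z, A z & a *: x + b *: y = (a + b) *: z.
Proof.
move=> /convex_setP cA a0 b0 Ax Ay; have [/eqP|ab0] := eqVneq (a + b) 0.
  rewrite paddr_eq0// => /andP[/eqP -> /eqP ->].
  by exists x => //; rewrite addr0 !scale0r addr0.
have ab : 0 < a + b by rewrite lt_neqAle eq_sym ab0 addr_ge0.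
exists ((a / (a + b)) *: x + (1 - a / (a + b)) *: y).
  by apply: cA => //; rewrite ?divr_ge0 ?ler_pdivrMr ?mul1r ?lerDl// ltW.
rewrite scalerDr !scalerA mulrBr mulr1 mulrCA divff// mulr1.
by rewrite [a + b - a]addrC addrA addNr add0r.
Qed.

Lemma convex_conv_hull A : @convex_set R Y (conv_hull A).
Proof.
apply/convex_setP => x y t t0 t1 Ax Ay B [/[dup] cB /convex_setP cB' AB].
by apply: cB' => //; [exact: Ax|exact: Ay].
Qed.

Lemma convex_setI A B : @convex_set R Y A -> @convex_set R Y B ->
  @convex_set R Y (A `&` B).
Proof.
move=> /convex_setP cA /convex_setP cB; apply/convex_setP.
by move=> x y t t0 t1 [? ?] [? ?]; split; [exact: cA|exact: cB].
Qed.

Section Linear.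
Context {g : Y -> R} (glin : linear (g : Y -> R^o)).

Lemma linear_form0 : g 0 = 0.
Proof.
by have := glin 1 0 0; rewrite scaler0 addr0 [_ *: _]mul1r => ?; lra.
Qed.

Lemma linear_formD x y : g (x + y) = g x + g y.
Proof. by rewrite -{1}[x]scale1r glin [_ *: _]mul1r. Qed.

Lemma linear_formZ a x : g (a *: x) = a * g x.
Proof. by rewrite -[a *: x]addr0 glin linear_form0 addr0. Qed.

Lemma linear_formN x : g (- x) = - g x.
Proof. by rewrite -scaleN1r linear_formZ mulN1r. Qed.

Lemma linear_formB x y : g (x - y) = g x - g y.
Proof. by rewrite linear_formD linear_formN. Qed.

Lemma convex_linear_le c : @convex_set R Y [set x | g x <= c].
Proof.
apply/convex_setP => x y t t0 t1 /= gx gy.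
rewrite linear_formD !linear_formZ; nra.
Qed.

Lemma convex_linear_ge c : @convex_set R Y [set x | c <= g x].
Proof.
apply/convex_setP => x y t t0 t1 /= gx gy.
rewrite linear_formD !linear_formZ; nra.
Qed.

Lemma convex_linear_gt c : @convex_set R Y [set x | c < g x].
Proof.
apply/convex_setP => x y t t0 t1 /= gx gy.
rewrite linear_formD !linear_formZ.
have [->|t0'] := eqVneq t 0; first by rewrite subr0 mul0r mul1r add0r.
have {}t0 : 0 < t by rewrite lt_neqAle eq_sym t0'.
nra.
Qed.

End Linear.


Lemma convex_disjoint_separation D V : D !=set0 ->
  @convex_set R Y D -> @convex_set R Y V -> V 0 ->
  (forall y, exists2 t, 0 < t & exists2 v, V v & y = t *: v) ->
  D `&` V = set0 ->
  exists2 g : Y -> R, linear (g : Y -> R^o) &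
    (forall v, V v -> g v <= 1) /\ (forall d, D d -> 1 <= g d).
Proof.
move=> [d0 Dd0] cD cV V0 Vabs DV0.
(* [inf {r | E (y, r)}] is the largest sublinear functional that is at most [1]
   on [V] and at most [-1] on [-D]. *)
pose E := [set q : Y * R | exists t l v d,
  [/\ 0 <= t, 0 <= l, V v, D d & q = (t *: v - l *: d, t - l)]].
have cE : upper_cone E.
  split.
  - by exists 0, 0, 0, d0; split => //; rewrite !scale0r !subr0.
  - move=> x y r s [t [l [v [d [t0 l0 Vv Dd [-> ->]]]]]].
    move=> [t' [l' [v' [d' [t'0 l'0 Vv' Dd' [-> ->]]]]]].
    have [v2 Vv2 ev] := convex_comb _ _ _ _ _ cV t0 t'0 Vv Vv'.
    have [d2 Dd2 ed] := convex_comb _ _ _ _ _ cD l0 l'0 Dd Dd'.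
    exists (t + t'), (l + l'), v2, d2; split => //; rewrite ?addr_ge0//.
    by rewrite -ev -ed !opprD; congr pair; exact: addrACA.
  - move=> a _ _ a0 [t [l [v [d [t0 l0 Vv Dd [-> ->]]]]]].
    have ge0 := ltW a0.
    exists (a * t), (a * l), v, d; split => //; rewrite ?mulr_ge0//.
    by rewrite scalerBr mulrBr !scalerA.
  - move=> _ [t [l [v [d [t0 l0 Vv Dd [/esym/eqP + ->]]]]]].
    rewrite subr_eq0 => /eqP tvld; rewrite leNgt subr_lt0; apply/negP => tl.
    (* With [t < l], [d = (t / l) *: v] is a convex combination of [v] and [0], hence a point of [D]
       in [V]. *)
    have lp : 0 < l by exact: le_lt_trans tl.
    suff : (D `&` V) d by rewrite DV0.
    split => //; have -> : d = (t / l) *: v + (1 - t / l) *: 0.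
      rewrite scaler0 addr0 mulrC -scalerA tvld scalerA.
      by rewrite mulVf ?gt_eqF// scale1r.
    by move/convex_setP : cV; apply => //;
      rewrite ?divr_ge0 ?ler_pdivrMr ?mul1r// ltW.
have Etot y : exists r, E (y, r).
  have [t t0 [v Vv ->]] := Vabs y; exists t, t, 0, v, d0; split => //.
    exact: ltW.
  by rewrite scale0r !subr0.
have [g glin gE] := hahn_banach _ cE Etot; exists g => //; split=> [v Vv|d Dd].
  by apply: gE; exists 1, 0, v, d0; split; rewrite // scale1r scale0r !subr0.
rewrite -lerN2 -(linear_formN glin); apply: gE.
by exists 0, 1, 0, d; split; rewrite // scale1r scaler0 !sub0r.
Qed.

End Convexity.

(** * Strict separation in locally convex spaces *)

Section Topology.
Context {R : realType} {Y : tvsType R}.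
Implicit Types (A B D V : set Y) (g : Y -> R).

(** On the intersection of [V] and [- V] the absolute value of [g] is at most [1], so it is at most
    [e] on [e] times that neighbourhood, which is then translated to [x]. *)
Lemma linear_form_continuous g V : linear (g : Y -> R^o) -> nbhs 0 V ->
  (forall v, V v -> g v <= 1) -> continuous g.
Proof.
move=> glin V0 gV x; apply/cvgrPdist_le => e e0.
have W0 : nbhs 0 (V `&` -%R @` V) by apply: filterI => //; exact: nbhs0N.
have e0' : e != 0 by rewrite gt_eqF.
near=> y; have [_ [w [Vw [w' Vw' w'E]] <-] <-] :
    [set x + z | z in *:%R e @` (V `&` -%R @` V)] y.
  by near: y; exact/nbhsT/nbhs0Z.
rewrite (linear_formD glin) opprD addrA subrr sub0r normrN.
rewrite (linear_formZ glin) normrM.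
rewrite gtr0_norm// -[leRHS]mulr1 ler_pM2l// ler_norml gV// andbT.
by rewrite -w'E (linear_formN glin) lerN2 gV.
Unshelve. all: by end_near. Qed.

Lemma nbhs0_convex V : nbhs (0 : Y) V ->
  exists U, [/\ nbhs (0 : Y) U, @convex_set R Y U & U `<=` V].
Proof.
have [B cB [Bo Bb]] := @locally_convex R Y.
move=> /Bb[U [BU U0] UV]; exists U; split => //; last by apply: cB; exact/mem_set.
by apply: open_nbhs_nbhs; split => //; exact: Bo.
Qed.

Lemma nbhs0_absorbing V : nbhs (0 : Y) V ->
  forall y, exists2 t, 0 < t & exists2 v, V v & y = t *: v.
Proof.
move=> V0 y.
have : \forall t \near (0 : R^o), V (t *: y).
  suff : {for (0 : R^o), continuous (fun t : R^o => t *: y)}.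
    by move=> /(_ V); rewrite /= scale0r => /(_ V0).
  apply: (@continuous_comp _ _ _ (fun t : R^o => (t, y))
    (fun z : R^o * Y => z.1 *: z.2)); last exact: scale_continuous.
  by apply: (@cvg_pair _ _ _ _ (nbhs (0 : R^o))); [exact: cvg_id|exact: cvg_cst].
move=> /nbhs_ballP[e /= e0 eV]; exists (e / 2)^-1; first by rewrite invr_gt0; lra.
exists ((e / 2) *: y); last by rewrite scalerA mulVf ?scale1r//; lra.
by apply: eV; rewrite /ball/= sub0r normrN gtr0_norm; lra.
Qed.

(** Each [a] in [A] has its own neighbourhood of [(a, 0)] on which sums avoid [B]; the near-covering
    form of compactness makes the choice of [v] uniform in [a]. *)
Lemma compact_closed_gap A B : compact A -> closed B -> A `&` B = set0 ->
  exists2 V, nbhs (0 : Y) V & forall a v, A a -> V v -> ~ B (a + v).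
Proof.
move=> /compact_near_coveringP cA cB AB0.
have VB : \forall v \near (0 : Y), A `<=` (fun a => ~ B (a + v)).
  apply: (cA _ (nbhs (0 : Y)) (fun v a => ~ B (a + v))).
  move=> a Aa; have nB : nbhs (a + 0) (~` B).
    rewrite addr0; apply: open_nbhs_nbhs; split; first exact: closed_openC.
    by move=> Ba; suff : (A `&` B) a by rewrite AB0.
  exact: (@add_continuous Y (a, 0) _ nB).
by exists [set v | A `<=` (fun a => ~ B (a + v))] => // a v Aa; exact.
Qed.

(** The difference set [B - A] misses a convex neighbourhood of [0]. Separating the two at level [1]
    gives the gap, and the bound on the neighbourhood gives continuity. *)
Theorem strict_separation A B : A !=set0 -> B !=set0 ->
  @convex_set R Y A -> @convex_set R Y B ->
  compact (closure A) -> closure A `&` closure B = set0 ->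
  exists2 g, top_dual Y g & forall a b, A a -> B b -> g a + 1 <= g b.
Proof.
move=> [a0 Aa0] [b0 Bb0] cA cB compA AB0.
have [V0 nV0 V0AB] := compact_closed_gap _ _ compA (@closed_closure _ B) AB0.
have [V [nV cV VV0]] := nbhs0_convex _ nV0.
pose D := [set d | exists a b, [/\ A a, B b & d = b - a]].
have cD : @convex_set R Y D.
  move/convex_setP : cA => cA; move/convex_setP : cB => cB.
  apply/convex_setP => _ _ t t0 t1 [a [b [Aa Bb ->]]] [a' [b' [Aa' Bb' ->]]].
  exists (t *: a + (1 - t) *: a'), (t *: b + (1 - t) *: b').
  split; [exact: cA|exact: cB|].
  by rewrite !scalerBr opprD addrACA.
have DV0 : D `&` V = set0.
  apply/seteqP; split => // _ [[a [b [Aa Bb ->]]] /VV0].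
  move=> /(V0AB _ _ (subset_closure Aa)); apply.
  by rewrite addrC subrK; exact: subset_closure.
have [|g glin [gV gD]] := convex_disjoint_separation D V _ cD cV
    (nbhs_singleton nV) (nbhs0_absorbing _ nV) DV0.
  by exists (b0 - a0), a0, b0.
exists g; first by split => //; exact: linear_form_continuous gV.
move=> a b Aa Bb; rewrite -lerBrDl -(linear_formB glin).
by apply: gD; exists a, b.
Qed.

End Topology.

(** * Scalarization with respect to a pointed convex cone *)

Lemma opp_setE {R : realType} {Y : lmodType R} (K : set Y) y :
  opp_set K y <-> K (- y).
Proof.
split=> [[z Kz <-]|Ky]; first by rewrite opprK.
by exists (- y) => //; rewrite opprK.
Qed.

Section Scalarization.
Context {R : realType} {X : Type} {Y : lmodType R}.
Context {Omega : set X} {f : X -> Y} {C : set Y} {xb : X}.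
Hypotheses (C0 : C 0) (CD : forall x y, C x -> C y -> C (x + y)).
Hypothesis CZ : forall t x, 0 <= t -> C x -> C (t *: x).
Hypothesis C_pointed : forall x, C x -> C (- x) -> x = 0.
Hypothesis xb_eff : Eff Omega f C xb.

(** A nonzero [f xb - f x] in [C] would refute efficiency. The scalarization results use efficiency
    only in this form. *)
Lemma Eff_eq x : Omega x -> C (f xb - f x) -> f x = f xb.
Proof.
move=> Ox Cx; apply: contrapT => nfx; case: xb_eff => _; apply; exists x => //.
exists (f xb - f x); last by rewrite subKr.
by split => //= /eqP; rewrite subr_eq0 => /eqP /esym.
Qed.

Section Ray.
Context {a k : Y} {s : R}.
Hypotheses (Ck : (C `\` lineality C) k) (fxb : f xb = a + s *: k).

Lemma ray_neq0 : k <> 0.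
Proof.
case: Ck => _ + k0; apply; rewrite k0; split => //.
by apply/opp_setE; rewrite oppr0.
Qed.

Lemma ray_eq x t : Omega x -> C (a + t *: k - f x) -> t <= s -> f x = f xb.
Proof.
move=> Ox Cx ts; apply: Eff_eq => //.
have -> : f xb - f x = (a + t *: k - f x) + (s - t) *: k.
  by rewrite scalerBl addrAC -(addrA a) subrKC fxb.
by apply: CD => //; apply: CZ; [rewrite subr_ge0|case: Ck].
Qed.

(** If [t < s], [ray_eq] gives [f x = f xb], so the hypothesis reads [(t - s) *: k] in [C]. Then
    [- k] is in [C], against pointedness. *)
Lemma ray_ge x t : Omega x -> C (a + t *: k - f x) -> s <= t.
Proof.
move=> Ox Cx; rewrite leNgt; apply/negP => ts.
have fx := ray_eq _ _ Ox Cx (ltW ts).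
apply: ray_neq0; apply: C_pointed; first by case: Ck.
move: Cx; rewrite fx fxb opprD addrACA subrr add0r -scalerBl => Cx.
have st : 0 < s - t by rewrite subr_gt0.
have := CZ _ _ (ltW (_ : 0 < (s - t)^-1)) Cx; rewrite invr_gt0 => /(_ st).
by rewrite scalerA -(opprB s t) mulrN mulVf ?gt_eqF// scaleN1r.
Qed.

Lemma solutions_ray (phi : Y -> R) : representing phi (opp_set C) ->
  [set (x, s) | x in [set x | Omega x /\ f x = f xb]] = solutions Omega f phi a k.
Proof.
move=> phiE; have feasE x t : feasible Omega f phi a k (x, t) <->
    Omega x /\ C (a + t *: k - f x).
  have -> : a + t *: k - f x = - (f x - a - t *: k).
    by rewrite !opprB addrA (addrC _ a).
  rewrite -opp_setE phiE; exact: iff_refl.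
apply/seteqP; split=> [_ [x [Ox fx] <-]|[x t] [/feasE[Ox Cx] tmin]].
  split; first by apply/feasE; rewrite fx -fxb subrr.
  by move=> [z t] /feasE[Oz Cz]; exact: ray_ge _ _ Oz Cz.
have ts : t <= s.
  apply: (tmin (xb, s)); apply/feasE.
  by split; [case: xb_eff|rewrite -fxb subrr].
exists x; first by split => //; exact: ray_eq _ _ Ox Cx ts.
by congr pair; apply/eqP; rewrite eq_le ts andbT; exact: ray_ge _ _ Ox Cx.
Qed.

(** By [ray_ge] no admissible parameter on [Omega] is below [s], and [xb] attains [s]. The
    hypothesis asks for closedness of [C] along the direction [k]. *)
Lemma gerstewitz_ray_argmin :
  (forall z, (forall e, 0 < e -> C (z + e *: k)) -> C z) ->
  gerstewitz a C k (f xb) = s%:E /\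
  [set x | Omega x /\ f x = f xb] =
    argmin Omega (fun x => gerstewitz a C k (f x)).
Proof.
move=> Cclosed.
have gsetE x t : [set t *: k + (a - c) | c in C] (f x) <-> C (a + t *: k - f x).
  split=> [[c Cc <-]|Cx]; first by rewrite addrA [t *: k + a]addrC subKr.
  by exists (a + t *: k - f x) => //; rewrite addrA [t *: k + a]addrC subKr.
have ger_ge x : Omega x -> (s%:E <= gerstewitz a C k (f x))%E.
  move=> Ox; apply: le_ereal_inf_tmp => _ [t /gsetE Ct <-].
  by rewrite lee_fin; exact: ray_ge _ _ Ox Ct.
have ger_xb : gerstewitz a C k (f xb) = s%:E.
  apply/eqP; rewrite eq_le ger_ge ?andbT; last by case: xb_eff.
  by apply: ereal_inf_lbound; exists s => //; apply/gsetE; rewrite -fxb subrr.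
split => //; apply/seteqP; split=> [x [Ox fx]|x [Ox xmin]].
  by split => // z Oz; rewrite fx ger_xb; exact: ger_ge.
split => //; have Oxb : Omega xb by case: xb_eff.
(* The infimum at a minimizer need not be attained: it only provides parameters below [s + e], and
   [Cclosed] removes [e]. *)
apply: Eff_eq => //; apply: Cclosed => e e0.
have : (gerstewitz a C k (f x) < (s + e)%:E)%E.
  by rewrite (le_lt_trans (xmin _ Oxb))// ger_xb lte_fin ltrDl.
move=> /ereal_inf_lt[_ [t /gsetE Ct <-]]; rewrite lte_fin => tse.
have -> : f xb - f x + e *: k = (a + t *: k - f x) + (s + e - t) *: k.
  by rewrite scalerBl [RHS]addrAC -(addrA a) subrKC scalerDl addrA fxb addrAC.
apply: CD => //; apply: CZ; last by case: Ck.
by rewrite subr_ge0 ltW.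
Qed.

End Ray.

(** A value at most [0] means that [f xb - f x] is in [C], hence [f x = f xb] and the value is [0];
    so [0] is the minimum. *)
Lemma argmin_representing (phi : Y -> R) :
  phi 0 = 0 -> representing phi (opp_set C) ->
  [set x | Omega x /\ f x = f xb] = argmin Omega (fun x => phi (f x - f xb)).
Proof.
move=> phi0 phiE.
have phi_le0 x : Omega x -> phi (f x - f xb) <= 0 -> f x = f xb.
  move=> Ox phix; apply: Eff_eq => //; rewrite -opprB -opp_setE.
  by rewrite phiE.
apply/seteqP; split=> [x [Ox fx]|x [Ox xmin]].
  split => // z Oz; rewrite fx subrr phi0 leNgt; apply/negP => phiz.
  by move: (phiz); rewrite (phi_le0 _ Oz (ltW phiz)) subrr phi0 ltxx.
split => //; apply: phi_le0 => //.
by have := xmin xb; rewrite subrr phi0; apply; case: xb_eff.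
Qed.

End Scalarization.

(** * Norms and Bishop-Phelps cones *)

Section Norm.
Context {R : realType} {Y : lmodType R} {N : Y -> R} (Nnorm : is_norm N).

Lemma is_norm0 : N 0 = 0.
Proof. by case: Nnorm => _ /(_ 0 0) NZ _; rewrite scale0r normr0 mul0r in NZ. Qed.

Lemma is_normN x : N (- x) = N x.
Proof. by case: Nnorm => _ NZ _; rewrite -scaleN1r NZ normrN normr1 mul1r. Qed.

Lemma is_norm_ge0 x : 0 <= N x.
Proof.
case: Nnorm => ND _ _; have := ND x (- x).
by rewrite subrr is_norm0 is_normN; lra.
Qed.

Lemma is_norm_gt0 x : x <> 0 -> 0 < N x.
Proof.
move=> x0; rewrite lt_neqAle is_norm_ge0 andbT eq_sym; apply/eqP => Nx0.
by apply: x0; case: Nnorm => _ _; apply.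
Qed.

Lemma is_normZ_ge0 t x : 0 <= t -> N (t *: x) = t * N x.
Proof. by case: Nnorm => _ NZ _ t0; rewrite NZ ger0_norm. Qed.

Lemma cone_scale (M : set Y) t x : cone M -> 0 <= t -> M x -> M (t *: x).
Proof.
move=> [_ ->] t0 [s s0 [y My <-]]; exists (t * s); first exact: mulr_ge0.
by exists y => //; rewrite scalerA.
Qed.

Lemma base_normalize (M : set Y) x : (forall t y, 0 <= t -> M y -> M (t *: y)) ->
  M x -> x <> 0 -> base N M ((N x)^-1 *: x).
Proof.
move=> MZ Mx /is_norm_gt0 Nx; have Ni : 0 <= (N x)^-1 by rewrite invr_ge0 ltW.
by split; [exact: MZ|rewrite is_normZ_ge0// mulVf// gt_eqF].
Qed.

Lemma convex_norm_le c : @convex_set R Y [set x | N x <= c].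
Proof.
apply/convex_setP => x y t t0 t1 /= Nx Ny; case: Nnorm => ND _ _.
rewrite (le_trans (ND _ _))// !is_normZ_ge0// ?subr_ge0//.
nra.
Qed.

Section BishopPhelps.
Context {xs : Y -> R} {alpha : R} (xs_lin : linear (xs : Y -> R^o)).
Hypothesis alpha_gt0 : 0 < alpha.
Let C := BP_cone N xs alpha.

Lemma BP_cone0 : C 0.
Proof. by rewrite /C /BP_cone /= is_norm0 mulr0 linear_form0. Qed.

Lemma BP_coneD x y : C x -> C y -> C (x + y).
Proof.
rewrite /C /BP_cone /= (linear_formD xs_lin) => Cx Cy.
case: Nnorm => /(_ x y) /(ler_wpM2l (ltW alpha_gt0)) + _ _; rewrite mulrDr; lra.
Qed.

Lemma BP_coneZ t x : 0 <= t -> C x -> C (t *: x).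
Proof.
rewrite /C /BP_cone /= (linear_formZ xs_lin) => t0 Cx.
by rewrite is_normZ_ge0// mulrCA ler_wpM2l.
Qed.

Lemma BP_cone_pointed x : C x -> C (- x) -> x = 0.
Proof.
rewrite /C /BP_cone /= is_normN (linear_formN xs_lin) => Cx Cnx.
case: Nnorm => _ _; apply; apply/eqP; rewrite eq_le is_norm_ge0 andbT.
rewrite -(pmulr_rle0 _ alpha_gt0); lra.
Qed.

Lemma BP_cone_closed_ray k z : (forall e, 0 < e -> C (z + e *: k)) -> C z.
Proof.
move=> Ce; rewrite /C /BP_cone /= leNgt; apply/negP => Nz.
(* Along [k] the defect [alpha * N - xs] falls at a rate of at most [m - 1]. A step [e] with [e * m]
   equal to the defect at [z] leaves it positive. *)
pose m := alpha * N k + `|xs k| + 1.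
have m0 : 0 < m.
  by rewrite ltr_wpDl// addr_ge0// mulr_ge0 ?is_norm_ge0// ltW.
pose e := (alpha * N z - xs z) / m.
have e0 : 0 < e by rewrite divr_gt0// subr_gt0.
have em : e * m = alpha * N z - xs z by rewrite /e divfK ?gt_eqF.
have := Ce _ e0.
rewrite /C /BP_cone /= (linear_formD xs_lin) (linear_formZ xs_lin).
have Nze : N z <= N (z + e *: k) + e * N k.
  case: Nnorm => ND _ _; have := ND (z + e *: k) (- (e *: k)).
  by rewrite addrK is_normN is_normZ_ge0// ltW.
have := ler_wpM2l (ltW alpha_gt0) Nze.
have := ler_wpM2l (ltW e0) (ler_norm (xs k)).
by move: em; rewrite /m !mulrDr mulr1 (mulrCA e); lra.
Qed.

(** A dominating point yields a nonzero [- c] in [A] with [c] in [C], that is, [xs] at [- c] is at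
    most [- (alpha * N c)], which the strict bound on [A] excludes. *)
Lemma Eff_BP_cone (X : Type) (Omega : set X) (f : X -> Y) (xb : X) (A : set Y) :
  Omega xb -> [set f x - f xb | x in Omega] `<=` A ->
  (forall a, A a -> a <> 0 -> - (alpha * N a) < xs a) ->
  Eff Omega f C xb.
Proof.
move=> Oxb fA Agt; split => // -[x Ox [c [Cc /= c0] cE]].
have : - c <> 0 by move=> nc0; apply: c0; rewrite -[c]opprK nc0 oppr0.
have Ac : A (- c) by apply: fA; exists x => //; rewrite -cE addrAC subrr sub0r.
move=> /(Agt _ Ac); rewrite is_normN (linear_formN xs_lin) ltrN2.
by rewrite ltNge => /negP; apply; exact: Cc.
Qed.

End BishopPhelps.
End Norm.

(** * Separating the base of [-K] from the hull of [0] and the base of [A] *)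

Lemma closure_sub_closed {T : topologicalType} (A B : set T) :
  closed B -> A `<=` B -> closure A `<=` B.
Proof. by move=> /closure_id + AB; move=> ->; exact: closureS. Qed.

Lemma closed_preimage_continuous {T : topologicalType} {R : realType}
    (g : T -> R) (D : set R) : continuous g -> closed D -> closed (g @^-1` D).
Proof. by move=> gc cD; apply: preimage_closed cD => x _; exact: gc. Qed.

Section AugmentedSeparation.
Context {R : realType} {Y : tvsType R} {N ys : Y -> R} {beta : R} {A : set Y}.
Hypotheses (Nnorm : is_norm N) (Ncont : continuous N).
Hypotheses (ys_dual : top_dual Y ys) (beta_gt0 : 0 < beta) (coneA : cone A).
Let K := BP_cone N ys beta.
Hypothesis AK0 : A `&` opp_set K = [set 0].

Let ys_lin : linear (ys : Y -> R^o). Proof. by case: ys_dual. Qed.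
Let ys_cont : continuous ys. Proof. by case: ys_dual. Qed.

Let opp_K x : N x <= 1 -> ys x <= - beta -> opp_set K x.
Proof.
move=> Nx ysx; apply/opp_setE.
rewrite /K /BP_cone /= (is_normN Nnorm) (linear_formN ys_lin).
apply: (@le_trans _ _ beta); last by rewrite lerNr.
by rewrite -[leRHS]mulr1 ler_pM2l.
Qed.

(** In the unit ball, [ys x <= - beta] puts [x] in [-K], so [x = 0], where [ys] vanishes. The whole
    ball is needed because hulls leave the unit sphere. *)
Lemma ys_gt_of_norm_le1 x : A x -> N x <= 1 -> - beta < ys x.
Proof.
move=> Ax Nx; rewrite ltNge; apply/negP => ysx.
have : (A `&` opp_set K) x by split => //; exact: opp_K.
rewrite AK0 => /= x0; move: ysx.
by rewrite x0 (linear_form0 ys_lin) oppr_ge0 leNgt beta_gt0.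
Qed.

Lemma base0_gt : [set 0] `|` base N A `<=` [set x | - beta < ys x].
Proof.
move=> x [->|[Ax Nx]] /=; first by rewrite (linear_form0 ys_lin) oppr_lt0.
by apply: ys_gt_of_norm_le1; rewrite ?Nx.
Qed.

Lemma conv_base0_gt : conv_base0 N A `<=` [set x | - beta < ys x].
Proof. exact: smallest_sub (convex_linear_gt ys_lin _) base0_gt. Qed.

Lemma conv_base_opp_le :
  closure (conv_base N (opp_set K)) `<=` [set x | ys x <= - beta].
Proof.
apply: closure_sub_closed.
  exact: (closed_preimage_continuous _ [set x | x <= - beta]).
apply: smallest_sub (convex_linear_le ys_lin _) _ => x [/opp_setE].
rewrite /K /BP_cone /= (is_normN Nnorm) (linear_formN ys_lin) => + Nx.
by rewrite Nx mulr1; lra.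
Qed.

Lemma closed_base_of_closed : closed A -> closed (base N A).
Proof.
move=> cA; apply: closedI => //.
exact: (closed_preimage_continuous _ [set x | x = 1]).
Qed.

Lemma closure_conv_base0_gt :
  (closed A /\ @convex_set R Y A) \/
    [\/ compact (base N A),
        closed (conv_base0 N A),
        closed A /\ compact (closure (base N A))
      | closed A /\ closed (conv_hull (closure (base N A) `|` [set 0]))] ->
  closure (conv_base0 N A) `<=` [set x | - beta < ys x].
Proof.
have A0 : A 0 by case: coneA.
(* The minimum of [ys] over [0] and the base is attained, so the hull lies in a closed half-space
   still strictly above [- beta]. *)
have of_compact : compact (base N A) ->
    closure (conv_base0 N A) `<=` [set x | - beta < ys x].
  move=> cB; have [|||c] := @compact_EVT_min Y R ys ([set 0] `|` base N A).
  - by exists 0; left.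
  - by apply: compactU => //; exact: compact_set1.
  - exact: continuous_subspaceT.
  move=> /set_mem /base0_gt /= cgt cmin.
  apply: subset_trans (_ : [set x | ys c <= ys x] `<=` _); last first.
    by move=> x /=; exact: lt_le_trans.
  apply: closure_sub_closed.
    exact: (closed_preimage_continuous _ [set x | ys c <= x]).
  apply: smallest_sub (convex_linear_ge ys_lin _) _ => x Bx /=.
  by apply: cmin; exact/mem_set.
have of_closed : closed (conv_base0 N A) ->
    closure (conv_base0 N A) `<=` [set x | - beta < ys x].
  by move=> /closure_id <-; exact: conv_base0_gt.
move=> [[cA convA]|[/of_compact|/of_closed|[cA cB]|[cA cS]]] //.
(* The closure stays in the closed convex intersection of [A] with the unit ball. *)
- move=> x Sx; suff [? ?] : (A `&` [set x | N x <= 1]) x.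
    exact: ys_gt_of_norm_le1.
  apply: closure_sub_closed Sx.
    apply: closedI => //.
    exact: (closed_preimage_continuous _ [set x | x <= 1]).
  apply: smallest_sub; first exact: convex_setI convA (convex_norm_le Nnorm _).
  by move=> y [->|[Ay Ny]]; split => //=; rewrite ?(is_norm0 Nnorm) ?Ny.
(* As [A] is closed, its base equals its closure, which reduces the last two alternatives to earlier
   ones. *)
- by apply: of_compact; have /closure_id -> := closed_base_of_closed cA.
- by apply: of_closed; rewrite /conv_base0 setUC;
    have /closure_id -> := closed_base_of_closed cA.
Qed.

Lemma augmented_separation : (exists2 k, K k & k <> 0) ->
  closure (conv_base0 N A) `<=` [set x | - beta < ys x] ->
  compact (closure (conv_base N (opp_set K))) \/
    compact (closure (conv_base0 N A)) ->
  exists xs alpha, [/\ top_dual Y xs, 0 < alpha,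
    forall y, K y -> y <> 0 -> alpha * N y < xs y
    & forall a, A a -> a <> 0 -> - (alpha * N a) < xs a].
Proof.
move=> [k Kk k0] Sgt Scomp.
have S0 : conv_base0 N A 0 by apply: sub_gen_smallest; left.
(* Normalizing [a] carries a bound on the hull over to [A] by homogeneity. *)
have A_gt xs alpha : linear (xs : Y -> R^o) ->
    (forall a, conv_base0 N A a -> - alpha < xs a) ->
    forall a, A a -> a <> 0 -> - (alpha * N a) < xs a.
  move=> xlin xgt a Aa a0; have Na := is_norm_gt0 Nnorm _ a0.
  have /xgt : conv_base0 N A ((N a)^-1 *: a).
    apply: sub_gen_smallest; right; apply: base_normalize => //.
    by move=> t y; exact: cone_scale.
  by rewrite (linear_formZ xlin) mulrC ltr_pdivlMr// mulNr.
case: Scomp => [compK|compA].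
- have KZ t y : 0 <= t -> opp_set K y -> opp_set K (t *: y).
    move=> t0 /opp_setE Ky; apply/opp_setE; rewrite -scalerN.
    exact: (BP_coneZ Nnorm ys_lin).
  have baseK y : K y -> y <> 0 ->
      conv_base N (opp_set K) ((N y)^-1 *: (- y)).
    move=> Ky y0; apply: sub_gen_smallest; rewrite -(is_normN Nnorm).
    apply: base_normalize => //; first by apply/opp_setE; rewrite opprK.
    by move=> ny0; apply: y0; rewrite -[y]opprK ny0 oppr0.
  have [|||||g [glin gcont] gsep] := @strict_separation R Y
      (conv_base N (opp_set K)) (conv_base0 N A) _ _ _ _ compK _.
  + by exists ((N k)^-1 *: (- k)); exact: baseK.
  + by exists 0.
  + exact: convex_conv_hull.
  + exact: convex_conv_hull.
  + apply/seteqP; split => // x [/conv_base_opp_le + /Sgt] /=.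
    by move=> /le_lt_trans /[apply]; rewrite ltxx.
  (* This infimum is genuine: [0] is in the hull, and the normalized [- k] bounds [g] below on
     it. *)
  pose m := inf (g @` conv_base0 N A).
  have gm y : K y -> y <> 0 -> g ((N y)^-1 *: (- y)) + 1 <= m.
    move=> Ky y0; apply: lb_le_inf; first by exists (g 0), 0.
    by move=> _ [b Sb <-]; apply: gsep => //; exact: baseK.
  have mg b : conv_base0 N A b -> m <= g b.
    move=> Sb; apply: ge_inf; last by exists b.
    exists (g ((N k)^-1 *: (- k)) + 1) => _ [b' Sb' <-].
    by apply: gsep => //; exact: baseK.
  have m0 : m <= 0 by rewrite -(linear_form0 glin); exact: mg.
  (* The level [- alpha] is midway between [m - 1], an upper bound on the base of [-K], and [m];
     [m <= 0] makes [alpha] positive. *)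
  exists g, (2^-1 - m); split => //.
  + lra.
  + move=> y Ky y0; have Ny := is_norm_gt0 Nnorm _ y0.
    rewrite -ltr_pdivlMr// mulrC; have := gm _ Ky y0.
    by rewrite (linear_formZ glin) (linear_formN glin) mulrN; lra.
  + by apply: A_gt => // a /mg; lra.
- have [|||c] := @compact_EVT_min Y R ys (closure (conv_base0 N A)).
  + by exists 0; exact: subset_closure.
  + exact: compA.
  + exact: continuous_subspaceT.
  move=> /set_mem /Sgt /= cgt cmin.
  have c0 : ys c <= 0.
    rewrite -(linear_form0 ys_lin); apply: cmin; apply/mem_set.
    exact: subset_closure.
  (* Here [- alpha] is midway between [- beta] and the minimum [ys c]; thus [alpha < beta], and
     [ys c <= 0] gives [alpha > 0]. *)
  exists ys, ((beta - ys c) / 2); split => //.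
  + by move: beta_gt0; lra.
  + move=> y Ky y0; have Ny := is_norm_gt0 Nnorm _ y0.
    by apply: (lt_le_trans _ Ky); rewrite ltr_pM2r//; lra.
  + apply: A_gt => // a Sa.
    have : ys c <= ys a by apply: cmin; apply/mem_set; exact: subset_closure.
    lra.
Qed.

End AugmentedSeparation.

Theorem corollary33 (R : realType) (X : topologicalLmodType R) (Y : tvsType R)
    (Omega : set X) (f : X -> Y) (AA : X -> set Y) (N : Y -> R)
    (ys : Y -> R) (beta : R) (xb : X) :
  dim_ge2 Y ->
  Omega !=set0 ->
  (forall x, Omega x -> cone (AA x)) ->
  is_norm N -> continuous N ->
  (top_dual Y `\ cst 0) ys -> 0 < beta ->
  let K := BP_cone N ys beta in
  let A := AA xb in
  nontrivial K ->
  PEff Omega f AA K xb ->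
  cone A ->
  [set 0] <> [set f x - f xb | x in Omega] ->
  [set f x - f xb | x in Omega] `<=` A ->
  compact (closure (conv_base N (opp_set K))) \/
    compact (closure (conv_base0 N A)) ->
  (closed A /\ @convex_set R Y A) \/
    [\/ compact (base N A),
        closed (conv_base0 N A),
        closed A /\ compact (closure (base N A))
      | closed A /\ closed (conv_hull (closure (base N A) `|` [set 0]))] ->
  exists (xs : Y -> R) (alpha : R),
    (aug_dual N K `&` (top_dual Y `*` [set t | 0 < t])) (xs, alpha) /\
    let C := BP_cone N xs alpha in
    Eff Omega f C xb /\
    (C <> lineality C ->
     forall phi : Y -> R,
     sublinear phi -> phi 0 = 0 -> representing phi (opp_set C) ->
     [/\ (* (i) *)
         forall k, (C `\` lineality C) k ->
           [set (x, 0) | x in [set x | Omega x /\ f x = f xb]] =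
           solutions Omega f phi (f xb) k,
         (* (ii) *)
         [set x | Omega x /\ f x = f xb] =
           argmin Omega (fun x => phi (f x - f xb)),
         (* (iii) *)
         forall (P T : set Y) (S : set R),
           T `<=` C `\` lineality C ->
           f @` Eff Omega f C `<=`
             [set p + q | p in P & q in [set s *: t | s in S & t in T]] ->
           exists a k s, [/\ P a, T k, S s &
             [set (x, s) | x in [set x | Omega x /\ f x = f xb]] =
             solutions Omega f phi a k]
       & (* (iv) *)
         forall (P T : set Y) (S : set R),
           T `<=` C `\` lineality C ->
           f @` Eff Omega f C `<=`
             [set p + q | p in P & q in [set s *: t | s in S & t in T]] ->
           closed C ->
           exists a k s, [/\ P a, T k, S s,
             gerstewitz a C k (f xb) = s%:E &
             [set x | Omega x /\ f x = f xb] =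
               argmin Omega (fun x => gerstewitz a C k (f x))]]).
Proof.
move=> _ _ _ Nnorm Ncont [ys_dual _] beta0 K A [K0 _] [[Oxb _] AK0] coneA _ fA
  Scomp Aalt.
have ys_lin : linear (ys : Y -> R^o) by case: ys_dual.
have [k Kk k0] : exists2 k, K k & k <> 0.
  apply: contrapT => nk; apply: K0; apply/seteqP; split=> [_ ->|x Kx].
    exact: (BP_cone0 Nnorm ys_lin).
  by apply: contrapT => x0; apply: nk; exists x.
have [||xs [alpha [xs_dual alpha0 Kgt Agt]]] :=
    augmented_separation Nnorm ys_dual beta0 coneA _ _ Scomp.
- by exists k.
- exact: closure_conv_base0_gt Aalt.
have xs_lin : linear (xs : Y -> R^o) by case: xs_dual.
exists xs, alpha; split.
  split => //; split => //=; first exact: ltW.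
  by move=> y [Ky y0]; rewrite subr_gt0; exact: Kgt.
move=> C.
have xb_eff : Eff Omega f C xb.
  exact: (Eff_BP_cone Nnorm xs_lin) fA Agt.
have C0 : C 0 := BP_cone0 Nnorm xs_lin.
have CD := @BP_coneD _ _ _ Nnorm _ _ xs_lin alpha0.
have CZ := @BP_coneZ _ _ _ Nnorm _ alpha xs_lin.
have Cpt := @BP_cone_pointed _ _ _ Nnorm _ _ xs_lin alpha0.
split => // _ phi _ phi0 phiE; split.
(* The ray through [f xb] itself, with [a = f xb] and [s = 0]. *)
- move=> k' Ck'; apply: (solutions_ray C0 CD CZ Cpt xb_eff Ck' _ _ phiE).
  by rewrite scale0r addr0.
- exact: (argmin_representing xb_eff).
(* As [xb] is efficient for [C], the covering hypothesis writes [f xb] as [a + s *: t]. *)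
- move=> P T S TC /(_ (f xb)) []; first by exists xb.
  move=> a Pa [_ [s Ss [t Tt <-]] fxb]; exists a, t, s; split => //.
  exact: (solutions_ray C0 CD CZ Cpt xb_eff (TC _ Tt) (esym fxb)).
- move=> P T S TC /(_ (f xb)) []; first by exists xb.
  move=> a Pa [_ [s Ss [t Tt <-]] fxb] _; exists a, t, s.
  have [] := gerstewitz_ray_argmin C0 CD CZ Cpt xb_eff (TC _ Tt) (esym fxb).
    by move=> z; exact: (BP_cone_closed_ray Nnorm xs_lin alpha0).
  by move=> ger_xb ger_min; split.
Qed.
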